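(* Let $q\in(0,1]$, let $n\ge 0$ be an integer, let $b^n_{ijk}\in\mathbb{R}$ be given for all integers $i,j,k\ge 0$ with $i+j+k=n$, and let $$\gamma^n(u,v)=\sum_{i+j+k=n}b^n_{ijk}B^n_{ijk}(u,v).$$ Then $\gamma^n$ can be written as a linear combination of the triangular $q$-Bernstein polynomials of degree $n+1$, $$\gamma^{n}(u,v)=\sum_{i+j+k=n+1}b_{ijk}^{n+1}B_{ijk}^{n+1}(u,v),$$ where, for all integers $i,j,k\ge 0$ with $i+j+k=n+1$, $$b_{ijk}^{n+1}=\frac{[n+1-k]}{[n+1]}\frac{i}{i+j}q^k\,b_{i-1,j,k}^{n}+\frac{[n+1-k]}{[n+1]}\frac{j}{i+j}q^k\,b_{i,j-1,k}^{n}+\frac{[k]}{[n+1]}\,b_{i,j,k-1}^{n}.$$ Here any term containing a coefficient $b^n$ with a negative index is taken to be $0$ (in particular, for $i=j=0$ the first two terms are $0$).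
   Context: For a real number $q>0$ and a natural number $r$, the $q$-integer is $[r]=1+q+\cdots+q^{r-1}$ (so $[r]=r$ if $q=1$, and $[0]=0$). The $q$-factorial is $[r]!=[r][r-1]\cdots[1]$ with $[0]!=1$. The $q$-binomial coefficient is $\genfrac{[}{]}{0pt}{}{i}{j}=\frac{[i]!}{[j]!\,[i-j]!}$ if $i\ge j\ge 0$, and $0$ otherwise. For an integer $n\ge 0$ and integers $i,j,k\ge 0$ with $i+j+k=n$, the triangular $q$-Bernstein polynomial is $$B^n_{ijk}(u,v)=\genfrac{[}{]}{0pt}{}{n}{k}\binom{i+j}{i}u^iv^j\prod_{s=0}^{k-1}(1-q^su-q^sv),$$ where an empty product equals $1$. Here $u,v$ are real variables, and sums over $i+j+k=m$ range over nonnegative integers $i,j,k$. *)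

(* Defs.v *)
From mathcomp Require Import all_boot all_order all_algebra.
From mathcomp Require Import reals.

Set Implicit Arguments.
Unset Strict Implicit.
Unset Printing Implicit Defensive.

Import Order.TTheory GRing.Theory Num.Theory.
Local Open Scope ring_scope.

Definition qint (R : realType) (q : R) (r : nat) : R := \sum_(s < r) q ^+ s.

Definition qfact (R : realType) (q : R) (r : nat) : R :=
  \prod_(1 <= s < r.+1) qint q s.

Definition qbinom (R : realType) (q : R) (i j : nat) : R :=
  if (j <= i)%N then qfact q i / (qfact q j * qfact q (i - j)) else 0.

(* Meaningful when i + j + k = n, although this is not enforced here. *)
Definition qbernstein (R : realType) (q : R) (n i j k : nat) (u v : R) : R :=
  qbinom q n k * 'C(i + j, i)%:R * u ^+ i * v ^+ j
  * \prod_(s < k) (1 - q ^+ s * u - q ^+ s * v).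

(* Only the values of b at triples with i + j + k = n are used. *)
Definition qbernstein_comb (R : realType) (q : R) (n : nat)
    (b : nat -> nat -> nat -> R) (u v : R) : R :=
  \sum_(i < n.+1) \sum_(j < n.+1) \sum_(k < n.+1 | (i + j + k == n)%N)
    b i j k * qbernstein q n i j k u v.

(* Main.v *)
(* Everything follows from writing B^n_{ijk} = (q^k u + q^k v + (1 - q^k u - q^k v)) B^n_{ijk}:
   the three products on the right are multiples of B^{n+1}_{i+1,j,k}, B^{n+1}_{i,j+1,k} and
   B^{n+1}_{i,j,k+1}. The sum over triples is then reindexed term by term. *)
Require Import Defs.
From mathcomp Require Import all_boot all_order all_algebra.
From mathcomp Require Import reals.
From mathcomp Require Import zify ring.

Set Implicit Arguments.
Unset Strict Implicit.
Unset Printing Implicit Defensive.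

Import Order.TTheory GRing.Theory Num.Theory.
Local Open Scope ring_scope.

Section TriangularSums.
Variable R : nmodType.
Implicit Types (F : nat -> nat -> nat -> R) (n : nat).

(** Same nesting and filter as [qbernstein_comb], hence convertible with it, but over an arbitrary
    summand so that reindexing ignores the Bernstein factors. *)
Definition trisum n F : R :=
  \sum_(i < n.+1) \sum_(j < n.+1) \sum_(k < n.+1 | (i + j + k == n)%N) F i j k.

Lemma eq_trisum n F G :
  (forall i j k, (i + j + k = n)%N -> F i j k = G i j k) ->
  trisum n F = trisum n G.
Proof.
move=> eqFG; apply: eq_bigr => i _; apply: eq_bigr => j _.
by apply: eq_bigr => k /eqP; apply: eqFG.
Qed.

Lemma trisumD n F G :
  trisum n (fun i j k => F i j k + G i j k) = trisum n F + trisum n G.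
Proof.
rewrite -big_split; apply: eq_bigr => i _.
by rewrite -big_split; apply: eq_bigr => j _; rewrite -big_split.
Qed.

(** The slice [i = 0] vanishes by the default [0], which models the convention on negative indices;
    the extra top values of [j] and [k] violate the degree constraint. *)
Lemma trisum_shift1 n F :
  trisum n.+1 (fun i j k => if i is i1.+1 then F i1 j k else 0) = trisum n F.
Proof.
rewrite /trisum big_ord_recl big1 ?add0r => [|j _]; last by rewrite big1.
apply: eq_bigr => i _; rewrite big_ord_recr /= [X in _ + X]big1 ?addr0.
  apply: eq_bigr => j _; rewrite big_mkcond big_ord_recr /= -big_mkcond /=.
  case: eqP => [|_]; last by rewrite addr0.
  by rewrite /bump; lia.
by move=> k /eqP; rewrite /bump; lia.
Qed.

Lemma trisum_shift2 n F :
  trisum n.+1 (fun i j k => if j is j1.+1 then F i j1 k else 0) = trisum n F.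
Proof.
rewrite /trisum big_ord_recr /= [X in _ + X]big1 ?addr0.
  apply: eq_bigr => i _; rewrite big_ord_recl big1 ?add0r //.
  apply: eq_bigr => j _; rewrite big_mkcond big_ord_recr /= -big_mkcond /=.
  case: eqP => [|_]; first by rewrite /bump; lia.
  by rewrite addr0; apply: eq_bigl => k; rewrite /bump; lia.
(* The slice [i = n.+1] only admits [j = 0], where the summand is the default [0]. *)
by move=> [[|j] ltj] _; apply: big1 => k //= /eqP; lia.
Qed.

Lemma trisum_shift3 n F :
  trisum n.+1 (fun i j k => if k is k1.+1 then F i j k1 else 0) = trisum n F.
Proof.
rewrite /trisum big_ord_recr /= [X in _ + X]big1 ?addr0.
  apply: eq_bigr => i _; rewrite big_ord_recr /= [X in _ + X]big1 ?addr0.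
    apply: eq_bigr => j _; rewrite big_mkcond big_ord_recl /=.
    rewrite -big_mkcond /= if_same add0r.
    by apply: eq_bigl => k; rewrite /bump; lia.
  by move=> [[|k] ltk] //= /eqP; lia.
by move=> j _; apply: big1 => -[[|k] ltk] //= /eqP; lia.
Qed.

End TriangularSums.

Lemma qbernstein_combE (R : realType) (q : R) n b u v :
  qbernstein_comb q n b u v
  = trisum n (fun i j k => b i j k * qbernstein q n i j k u v).
Proof. by []. Qed.

Section DegreeRaising.
Variables (R : realType) (q : R).
Hypothesis q_gt0 : 0 < q.

(** The term [q ^+ 0 = 1] is positive and the others are nonnegative. Positivity of [q] enters here
    and justifies every division by a [q]-integer or [q]-factorial. *)
Lemma qint_neq0 r : qint q r.+1 != 0.
Proof.
rewrite gt_eqF // /qint big_ord_recl expr0 ltr_pwDl ?ltr01 //.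
by apply: sumr_ge0 => s _; rewrite exprn_ge0 ?ltW.
Qed.

Lemma qfactS r : qfact q r.+1 = qfact q r * qint q r.+1.
Proof. by rewrite /qfact big_nat_recr. Qed.

Lemma qfact_neq0 r : qfact q r != 0.
Proof.
elim: r => [|r IHr]; first by rewrite /qfact big_geq ?oner_neq0.
by rewrite qfactS mulf_neq0 ?qint_neq0.
Qed.

(** Writing the upper index as [m + k] removes both the case split and the truncated subtraction. *)
Lemma qbinomD m k : qbinom q (m + k) k = qfact q (m + k) / (qfact q k * qfact q m).
Proof. by rewrite /qbinom leq_addl addnK. Qed.

Lemma qbinomSl m k :
  qint q m.+1 / qint q (m + k).+1 * qbinom q (m + k).+1 k = qbinom q (m + k) k.
Proof.
rewrite -addSn !qbinomD addSn !qfactS.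
by field; rewrite !qfact_neq0 !qint_neq0.
Qed.

Lemma qbinomSS m k :
  qint q k.+1 / qint q (m + k).+1 * qbinom q (m + k).+1 k.+1 = qbinom q (m + k) k.
Proof.
rewrite -addnS !qbinomD addnS !qfactS.
by field; rewrite !qfact_neq0 !qint_neq0.
Qed.

(** Absorption identity, divided by [m.+1]. *)
Lemma binSS_div m i : (i.+1%:R / m.+1%:R * 'C(m.+1, i.+1)%:R = 'C(m, i)%:R :> R).
Proof.
apply: (mulfI (_ : m.+1%:R != 0)); first by rewrite pnatr_eq0.
rewrite -natrM mul_bin_diag natrM mulrA mulrCA divff ?mulr1 //.
by rewrite pnatr_eq0.
Qed.

(** Mirror image of [binSS_div] under the symmetry of binomial coefficients. *)
Lemma binS_div i j :
  (j.+1%:R / (i + j).+1%:R * 'C((i + j).+1, i)%:R = 'C(i + j, i)%:R :> R).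
Proof.
rewrite -(bin_sub (leq_addr j i)) addKn -binSS_div.
by rewrite -[in RHS]bin_sub ?ltnS ?leq_addl // subSS addnK.
Qed.

(** The [q]-ratio lowers the [q]-binomial, the ordinary ratio lowers the binomial, and one factor
    [u] is left over; the product over [s] depends on [k] alone and is unchanged. *)
Lemma qbernsteinSi i j k u v :
  qint q (i + j).+1 / qint q (i + j + k).+1 * (i.+1%:R / (i + j).+1%:R) * q ^+ k
    * qbernstein q (i + j + k).+1 i.+1 j k u v
  = q ^+ k * u * qbernstein q (i + j + k) i j k u v.
Proof.
by rewrite /qbernstein -(qbinomSl (i + j)) -(binSS_div (i + j)) addSn exprS; ring.
Qed.

Lemma qbernsteinSj i j k u v :
  qint q (i + j).+1 / qint q (i + j + k).+1 * (j.+1%:R / (i + j).+1%:R) * q ^+ k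
    * qbernstein q (i + j + k).+1 i j.+1 k u v
  = q ^+ k * v * qbernstein q (i + j + k) i j k u v.
Proof.
by rewrite /qbernstein -(qbinomSl (i + j)) -(binS_div i j) addnS exprS; ring.
Qed.

(** The linear factor is the term [s = k] of the longer product. *)
Lemma qbernsteinSk i j k u v :
  qint q k.+1 / qint q (i + j + k).+1
    * qbernstein q (i + j + k).+1 i j k.+1 u v
  = (1 - q ^+ k * u - q ^+ k * v) * qbernstein q (i + j + k) i j k u v.
Proof.
by rewrite /qbernstein -(qbinomSS (i + j)) big_ord_recr /=; ring.
Qed.

End DegreeRaising.

Theorem proposition5p1 (R : realType) (q : R) (hq0 : 0 < q) (hq1 : q <= 1)
    (n : nat) (b : nat -> nat -> nat -> R) :
  exists b' : nat -> nat -> nat -> R,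
    (forall i j k : nat, (i + j + k = n.+1)%N ->
       b' i j k =
         (if i is i1.+1 then
            qint q (n.+1 - k) / qint q n.+1 * (i%:R / (i + j)%:R) * q ^+ k
            * b i1 j k
          else 0)
         + (if j is j1.+1 then
              qint q (n.+1 - k) / qint q n.+1 * (j%:R / (i + j)%:R) * q ^+ k
              * b i j1 k
            else 0)
         + (if k is k1.+1 then
              qint q k / qint q n.+1 * b i j k1
            else 0)) /\
    (forall u v : R,
       qbernstein_comb q n b u v = qbernstein_comb q n.+1 b' u v).
Proof.
(* The witness stays open until [reflexivity] unifies it with the prescribed coefficient. *)
eexists (fun i j k => _); split; first by move=> i j k _; reflexivity.
move=> u v; rewrite !qbernstein_combE.
pose B := qbernstein q n.+1.
(* [F1], [F2], [F3] are the three contributions to the degree [n.+1] sum, indexed by the triple of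
   the coefficient of [b] they contain. *)
pose F1 i j k := qint q (n.+1 - k) / qint q n.+1 * (i.+1%:R / (i.+1 + j)%:R)
  * q ^+ k * b i j k * B i.+1 j k u v.
pose F2 i j k := qint q (n.+1 - k) / qint q n.+1 * (j.+1%:R / (i + j.+1)%:R)
  * q ^+ k * b i j k * B i j.+1 k u v.
pose F3 i j k := qint q k.+1 / qint q n.+1 * b i j k * B i j k.+1 u v.
transitivity (trisum n (fun i j k => F1 i j k + F2 i j k + F3 i j k)).
  apply: eq_trisum => i j k def_n; rewrite /F1 /F2 /F3 /B -def_n.
  have -> : qbernstein q (i + j + k) i j k u v
      = q ^+ k * u * qbernstein q (i + j + k) i j k u v
      + q ^+ k * v * qbernstein q (i + j + k) i j k u v
      + (1 - q ^+ k * u - q ^+ k * v) * qbernstein q (i + j + k) i j k u v by ring.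
  rewrite -qbernsteinSi // -qbernsteinSj // -qbernsteinSk //.
  (* Here [n.+1 - k] becomes [(i + j).+1]. *)
  by rewrite -[(i + j + k).+1]addSn addnK !addSn addnS; ring.
rewrite !trisumD -trisum_shift1 -(trisum_shift2 n F2) -(trisum_shift3 n F3).
rewrite -!trisumD; apply: eq_trisum => i j k _.
(* At index [0] both sides are [0]; at a successor they agree by definition, so the quotient by
   [i + j] only occurs with [i + j] positive. *)
by rewrite 2!mulrDl; congr (_ + _ + _); [case: i|case: j|case: k] => *; rewrite ?mul0r.
Qed.
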